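(* Let $\alpha\ge 1$ and $n\ge 1$ be integers. The flag descent statistic $\mathrm{fdes}$ is symmetrically distributed about $\alpha(n-1)/2$ over the set $\mathbb{Z}_\alpha\wr\mathfrak{S}_n^{0}$ of colored permutations with last color $0$; that is, for every integer $k$, $$\bigl|\{w\in\mathbb{Z}_\alpha\wr\mathfrak{S}_n^{0} : \mathrm{fdes}(w)=k\}\bigr|=\bigl|\{w\in\mathbb{Z}_\alpha\wr\mathfrak{S}_n^{0} : \mathrm{fdes}(w)=\alpha(n-1)-k\}\bigr|.$$ As a consequence, the polynomial $\mathcal{F}_n^\alpha(x)$ is palindromic, i.e. $x^{\alpha(n-1)}\mathcal{F}_n^\alpha(1/x)=\mathcal{F}_n^\alpha(x)$.
   Context: $\mathbb{Z}_\alpha$ is the cyclic group of order $\alpha$ with elements $0,1,\dots,\alpha-1$, and $\mathfrak{S}_n$ is the symmetric group on $\{1,\dots,n\}$. Elements of the wreath product $\mathbb{Z}_\alpha\wr\mathfrak{S}_n=(\mathbb{Z}_\alpha)^n\ltimes\mathfrak{S}_n$ (colored permutations) are written $w=w_1^{c_1}w_2^{c_2}\cdots w_n^{c_n}$, where $w_1w_2\cdots w_n\in\mathfrak{S}_n$ is in one-line notation and each color $c_i\in\mathbb{Z}_\alpha$. The product is $$w_1^{c_1}\cdots w_n^{c_n}\cdot y_1^{d_1}\cdots y_n^{d_n}=w_{y_1}^{d_1+c_{y_1}}\cdots w_{y_n}^{d_n+c_{y_n}},$$ with exponents taken modulo $\alpha$. The set $\mathbb{Z}_\alpha\wr\mathfrak{S}_n^{0}$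 consists of the colored permutations in $\mathbb{Z}_\alpha\wr\mathfrak{S}_n$ with last color $c_n=0$. The flag descent statistic of $w=w_1^{c_1}\cdots w_n^{c_n}$ is the integer $$\mathrm{fdes}(w)=\alpha\cdot|\{i : c_i=c_{i+1},\ w_i>w_{i+1}\}|+\alpha\cdot|\{i : c_i<c_{i+1}\}|+c_1,$$ where $i$ ranges over $\{1,\dots,n-1\}$, colors are compared in the linear order $0<1<\cdots<\alpha-1$, and the addition of $c_1\in\{0,\dots,\alpha-1\}$ takes place in $\mathbb{Z}$. Let $H$ be the cyclic subgroup of $\mathbb{Z}_\alpha\wr\mathfrak{S}_n$ generated by $1^{1}2^{1}\cdots n^{1}$ (the identity permutation with all colors $1$). Each coset of $H$ contains exactly one element with last color $0$, and the polynomial $$\mathcal{F}_n^\alpha(x)=\sum_{\pi\in(\mathbb{Z}_\alpha\wr\mathfrak{S}_n)/H}x^{\mathrm{fdes}(\pi)}$$ is defined by evaluating $\mathrm{fdes}$ on the coset representative with last color $0$; that is, $\mathcal{F}_n^\alpha(x)=\sum_{\pi\in\mathbb{Z}_\alpha\wr\mathfrak{S}_n^{0}}x^{\mathrm{fdes}(\pi)}$. It has degree $\alpha(n-1)$. *)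

(* Defs.v *)
From HB Require Import structures.
From mathcomp Require Import all_boot all_order all_algebra all_fingroup.

Set Implicit Arguments.
Unset Strict Implicit.
Unset Printing Implicit Defensive.

Import Order.TTheory GRing.Theory Num.Theory.

Local Open Scope ring_scope.

(* Positions and letters 1, ..., n are represented by 0, ..., n - 1.  For      *)
(* n > 0 and alpha > 0, 'I_n.-1.+1 is 'I_n and 'I_alpha.-1.+1 is 'I_alpha;     *)
(* this form gives access to ord0 and ord_max, and to the additive group of    *)
(* integers mod alpha.  ('Z_alpha would be wrong for alpha = 1: it has two     *)
(* elements.)                                                                  *)
Record cperm (alpha n : nat) := CPerm {
  letter : 'S_n.-1.+1;
  color : {ffun 'I_n.-1.+1 -> 'I_alpha.-1.+1}
}.

Definition cperm_pair alpha n (w : cperm alpha n) := (letter w, color w).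
Definition pair_cperm alpha n
    (p : 'S_n.-1.+1 * {ffun 'I_n.-1.+1 -> 'I_alpha.-1.+1}) : cperm alpha n :=
  CPerm p.1 p.2.

Lemma cperm_pairK alpha n : cancel (@cperm_pair alpha n) (@pair_cperm alpha n).
Proof. by case. Qed.

HB.instance Definition _ alpha n :=
  Finite.copy (cperm alpha n) (can_type (@cperm_pairK alpha n)).

(* In MathComp (s * t)%g is "s, then t": the first component of cmul w y is    *)
(* i |-> w_(y_i).                                                              *)
Definition cmul alpha n (w y : cperm alpha n) : cperm alpha n :=
  CPerm (letter y * letter w)%g
        [ffun i => color y i + color w (letter y i)].

Definition cone alpha n : cperm alpha n := CPerm 1%g [ffun=> 0].

Definition cinv alpha n (w : cperm alpha n) : cperm alpha n :=
  CPerm (letter w)^-1%g [ffun i => - color w ((letter w)^-1%g i)].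

Lemma cperm_ext alpha n (w y : cperm alpha n) :
  letter w = letter y -> color w =1 color y -> w = y.
Proof. by case: w y => [s c] [t d] /= -> /ffunP ->. Qed.

Lemma cmulA alpha n : associative (@cmul alpha n).
Proof.
move=> w y z; apply: cperm_ext => [|i] /=; first by rewrite mulgA.
by rewrite !ffunE /= permM addrA.
Qed.

Lemma cmul1w alpha n : left_id (@cone alpha n) (@cmul alpha n).
Proof.
move=> w; apply: cperm_ext => [|i] /=; first by rewrite mulg1.
by rewrite !ffunE addr0.
Qed.

Lemma cmulVw alpha n : left_inverse (@cone alpha n) (@cinv alpha n) (@cmul alpha n).
Proof.
move=> w; apply: cperm_ext => [|i] /=; first by rewrite mulgV.
by rewrite !ffunE /= permK addrN.
Qed.

HB.instance Definition _ alpha n := Finite_isGroup.Build (cperm alpha n)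
  (@cmulA alpha n) (@cmul1w alpha n) (@cmulVw alpha n).

Definition last_color alpha n (w : cperm alpha n) := color w ord_max.

Definition wreath0 alpha n : {set cperm alpha n} :=
  [set w | last_color w == 0].

(* The positions i and i + 1, for i ranging over {1, ..., n - 1}.              *)
Definition pos n (i : 'I_n.-1) : 'I_n.-1.+1 := widen_ord (leqnSn n.-1) i.
Definition pos_next n (i : 'I_n.-1) : 'I_n.-1.+1 := lift ord0 i.

Definition fdes alpha n (w : cperm alpha n) : nat :=
  (alpha * #|[set i : 'I_n.-1 |
       (color w (pos i) == color w (pos_next i))
       && (letter w (pos_next i) < letter w (pos i))%N]|
   + alpha * #|[set i : 'I_n.-1 |
       (color w (pos i) < color w (pos_next i))%N]|
   + color w ord0)%N.

(* 1^1 2^1 ... n^1 *)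
Definition all_ones alpha n : cperm alpha n := CPerm 1%g [ffun=> inZp 1].

Definition Hgrp alpha n : {group cperm alpha n} := <[all_ones alpha n]>%G.

(* By coset_rep_uniq below the default value of odflt is never used.           *)
Definition coset_rep alpha n (C : {set cperm alpha n}) : cperm alpha n :=
  odflt 1%g [pick w in C | w \in wreath0 alpha n].

Definition Fpoly alpha n : {poly int} :=
  \sum_(C in lcosets (Hgrp alpha n) [set: cperm alpha n])
     'X^(fdes (coset_rep C)).

(* p(r) for a rational function r over the integers *)
Definition eval_frac (p : {poly int}) (r : {fraction {poly int}}) :
    {fraction {poly int}} :=
  (map_poly intr p).[r].

Lemma all_onesX alpha n k :
  (all_ones alpha n ^+ k)%g = CPerm 1%g [ffun=> inZp k].
Proof.
elim: k => [|k IHk].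
  by rewrite expg0; apply: cperm_ext => [|i] //=; rewrite !ffunE; apply: val_inj.
rewrite expgSr IHk; apply: cperm_ext => [|i] /=; first by rewrite mulg1.
by rewrite !ffunE; apply: val_inj; rewrite /= modnDm add1n.
Qed.

Lemma mem_lcosetH alpha n (w y : cperm alpha n) :
  reflect (exists k, letter y = letter w
             /\ forall i, color y i = inZp k + color w i)
          (y \in (w *: Hgrp alpha n)%g).
Proof.
apply: (iffP lcosetP) => [[_ /cycleP[k ->] ->]|[k [yw cyw]]].
  exists k; rewrite all_onesX; split=> [|i] /=; first by rewrite mul1g.
  by rewrite !ffunE perm1.
exists (all_ones alpha n ^+ k)%g; first exact: mem_cycle.
rewrite all_onesX; apply: cperm_ext => [|i] /=; first by rewrite mul1g.
by rewrite !ffunE perm1.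
Qed.

Lemma coset_rep_uniq alpha n (C : {set cperm alpha n}) :
  C \in lcosets (Hgrp alpha n) [set: cperm alpha n] ->
  exists! w, w \in C /\ w \in wreath0 alpha n.
Proof.
case/lcosetsP=> w _ ->.
pose c := - last_color w.
exists (CPerm (letter w) [ffun i => c + color w i]); split.
  split; last by rewrite inE /last_color ffunE addNr.
  apply/mem_lcosetH; exists (val c); split=> // i.
  by rewrite ffunE; congr (_ + _); rewrite valZpK.
move=> y [/mem_lcosetH[k [yw cyw]]]; rewrite inE /last_color cyw => /eqP k0.
apply: cperm_ext => [//|i] /=; rewrite ffunE cyw.
by congr (_ + _); apply/esym/eqP; rewrite -addr_eq0 k0.
Qed.

Lemma coset_repP alpha n (C : {set cperm alpha n}) :
  C \in lcosets (Hgrp alpha n) [set: cperm alpha n] ->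
  coset_rep C \in C /\ coset_rep C \in wreath0 alpha n.
Proof.
move=> /coset_rep_uniq[w [[wC w0] _]]; rewrite /coset_rep.
by case: pickP => [y /andP[]|/(_ w)] //=; rewrite wC w0.
Qed.

Lemma FpolyE alpha n :
  Fpoly alpha n = \sum_(w in wreath0 alpha n) 'X^(fdes w).
Proof.
have HL w : (w *: Hgrp alpha n)%g \in lcosets (Hgrp alpha n) [set: cperm alpha n].
  by apply/lcosetsP; exists w; rewrite ?inE.
have repH w : w \in wreath0 alpha n -> coset_rep (w *: Hgrp alpha n)%g = w.
  move=> w0; have [y [_ yU]] := coset_rep_uniq (HL w).
  rewrite -[RHS](yU _ (conj (lcoset_refl _ _) w0)).
  exact: esym (yU _ (coset_repP (HL w))).
rewrite /Fpoly (reindex_onto (fun w => (w *: Hgrp alpha n)%g) (@coset_rep _ _)).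
  apply: eq_big => [w|w /andP[_ /eqP ->] //].
  rewrite HL /=; apply/eqP/idP => [<-|/repH //].
  by have [] := coset_repP (HL w).
move=> C CL; have [rC _] := coset_repP CL.
by case/lcosetsP: CL rC => w _ -> /lcoset_eqP.
Qed.

(* Main.v *)
Require Import Defs.
From mathcomp Require Import all_boot all_order all_algebra all_fingroup.
From mathcomp Require Import zify.

(** Read along w, the colors go down by the residues
    r_i = c_i - c_(i+1) mod alpha, 0 <= r_i < alpha, from c_1 to c_n.  As
    integers, c_i - c_(i+1) = r_i - alpha * [c_i < c_(i+1)], so telescoping gives
      c_1 + alpha * |{i : c_i < c_(i+1)}| = c_n + r_1 + ... + r_(n-1).
    Hence, when c_n = 0, fdes is a sum of local contributions ([fdes_steps]):
    position i contributes r_i, plus alpha if r_i = 0 and w_i > w_(i+1), which is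
    an integer between 0 and alpha.

    The involution [ccompl] negates every color in Z_alpha and replaces each
    letter w_i by n + 1 - w_i.  It keeps the last color 0.  It turns a nonzero
    r_i into alpha - r_i, and at the positions with r_i = 0 it exchanges ascents
    and descents, so every contribution e_i becomes alpha - e_i ([step_ccompl]).
    Therefore fdes (w) + fdes (ccompl w) = alpha * (n - 1), which is the symmetry
    of the distribution, and reindexing the sum that defines F along the
    involution gives palindromicity. *)

Set Implicit Arguments.
Unset Strict Implicit.
Unset Printing Implicit Defensive.

Import Order.TTheory GRing.Theory Num.Theory.

Local Open Scope ring_scope.

Definition step alpha n (w : cperm alpha n) (i : 'I_n.-1) : nat :=
  ((color w (pos i) - color w (pos_next i))%R
   + alpha * ((color w (pos i) == color w (pos_next i))
              && (letter w (pos_next i) < letter w (pos i))%N))%N.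

Lemma val_ord_opp m (a : 'I_m.+1) :
  nat_of_ord (- a) = (if a == 0%R then 0 else m.+1 - a)%N.
Proof.
case: eqVneq => [->|]; first by rewrite oppr0.
by rewrite -val_eqE /= => a0; have := ltn_ord a; rewrite modn_small //; lia.
Qed.

(** The residue exceeds the integer difference by one modulus exactly when
    a < b: this is how the color ascents enter fdes. *)
Lemma val_ord_sub m (a b : 'I_m.+1) :
  ((a - b)%R + b = a + m.+1 * (a < b))%N.
Proof.
have am := ltn_ord a; have bm := ltn_ord b.
have -> : nat_of_ord (a - b)%R = ((a + (- b)%R) %% m.+1)%N by [].
rewrite val_ord_opp; case: eqVneq => [->|_].
  by rewrite !addn0 ltn0 muln0 addn0 modn_small.
case: ltnP => ab; first by rewrite modn_small /=; lia.
have -> : (a + (m.+1 - b) = (a - b) + m.+1)%N by lia.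
by rewrite modnDr modn_small; lia.
Qed.

Lemma card_set_sum (T : finType) (P : pred T) :
  #|[set i | P i]| = (\sum_i P i)%N.
Proof. by rewrite -sum1dep_card big_mkcond; apply: eq_bigr => i _; case: (P i). Qed.

Lemma fdes_steps alpha n (w : cperm alpha.+1 n) :
  fdes w = (\sum_i step w i + last_color w)%N.
Proof.
(* Both sides are the sum of all colors. *)
have tele : (color w ord0 + \sum_(i < n.-1) color w (pos_next i)
             = \sum_(i < n.-1) color w (pos i) + last_color w)%N.
  transitivity (\sum_(j < n.-1.+1) color w j)%N; last by rewrite big_ord_recr.
  by rewrite big_ord_recl.
have res : (\sum_(i < n.-1) (color w (pos i) - color w (pos_next i))%R
            + \sum_(i < n.-1) color w (pos_next i)
            = \sum_(i < n.-1) color w (pos i)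
              + alpha.+1 * \sum_(i < n.-1)
                             (color w (pos i) < color w (pos_next i)))%N.
  rewrite big_distrr -!big_split.
  by apply: eq_bigr => i _; exact: val_ord_sub.
have -> : (\sum_i step w i
           = \sum_(i < n.-1) (color w (pos i) - color w (pos_next i))%R
             + alpha.+1 * \sum_(i < n.-1)
                            ((color w (pos i) == color w (pos_next i))
                             && (letter w (pos_next i) < letter w (pos i))))%N.
  by rewrite big_distrr -big_split.
rewrite /fdes !card_set_sum.
by move: (_ * _)%N (_ * _)%N => D A in res *; lia.
Qed.

Definition ccompl alpha n (w : cperm alpha n) : cperm alpha n :=
  CPerm (letter w * perm (@rev_ord_inj n.-1.+1))%g [ffun i => - color w i].

Lemma ccomplK alpha n : involutive (@ccompl alpha n).
Proof.
move=> w; apply: cperm_ext => [|i] /=; last by rewrite !ffunE opprK.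
by apply/permP => i; rewrite !permM !permE rev_ordK.
Qed.

Lemma ccompl_wreath0 alpha n (w : cperm alpha n) :
  (ccompl w \in wreath0 alpha n) = (w \in wreath0 alpha n).
Proof. by rewrite !inE /last_color ffunE oppr_eq0. Qed.

(** Equal colors at i and i + 1 remain equal, and then reversing the order of the
    letters exchanges descents and ascents, the contributions alpha and 0;
    distinct colors contribute their nonzero residue, and r and - r sum to
    alpha. *)
Lemma step_ccompl alpha n (w : cperm alpha.+1 n) (i : 'I_n.-1) :
  (step w i + step (ccompl w) i)%N = alpha.+1.
Proof.
rewrite /step !ffunE eqr_opp -opprD val_ord_opp subr_eq0.
case: eqVneq => [->|_]; last first.
  by rewrite !andFb !muln0 !addn0 subnKC // ltnW.
have neq_w : letter w (pos i) != letter w (pos_next i) :> nat.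
  apply/eqP => /val_inj/perm_inj/(congr1 val) /=; rewrite /bump; lia.
have := ltn_ord (letter w (pos i)); have := ltn_ord (letter w (pos_next i)).
rewrite subrr [letter (ccompl w)]/= !permM !permE /=.
case: (ltngtP (letter w (pos i))) neq_w; lia.
Qed.

Lemma fdes_ccompl alpha n (w : cperm alpha.+1 n) :
  w \in wreath0 alpha.+1 n ->
  (fdes w + fdes (ccompl w) = alpha.+1 * (n - 1))%N.
Proof.
move=> w0; have cw0 : ccompl w \in wreath0 alpha.+1 n by rewrite ccompl_wreath0.
move: w0 cw0; rewrite !inE => /eqP w0 /eqP cw0.
rewrite !fdes_steps w0 cw0 !addn0 -big_split /=.
rewrite (eq_bigr (fun=> alpha.+1)) => [|i _]; last exact: step_ccompl.
by rewrite sum_nat_const card_ord mulnC subn1.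
Qed.

Lemma eval_frac_Fpoly alpha n r :
  eval_frac (Fpoly alpha n) r = \sum_(w in wreath0 alpha n) r ^+ fdes w.
Proof.
rewrite FpolyE /eval_frac rmorph_sum horner_sum.
by apply: eq_bigr => w _; rewrite /= map_polyXn hornerXn.
Qed.

Theorem theorem3p4 (alpha n : nat) (alpha_ge1 : (1 <= alpha)%N)
    (n_ge1 : (1 <= n)%N) :
  (forall k : int,
     #|[set w in wreath0 alpha n | (fdes w)%:Z == k]|
     = #|[set w in wreath0 alpha n |
            (fdes w)%:Z == alpha%:Z * (n%:Z - 1) - k]|)
  /\ (let x : {fraction {poly int}} := tofrac 'X in
      x ^+ (alpha * (n - 1)) * eval_frac (Fpoly alpha n) x^-1
      = eval_frac (Fpoly alpha n) x).
Proof.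
case: alpha alpha_ge1 => // alpha _; split=> [k|x].
  rewrite -(card_preimset _ (inv_inj (@ccomplK alpha.+1 n))).
  apply: eq_card => w; rewrite !inE.
  have := ccompl_wreath0 w; rewrite !inE => ->.
  case: (boolP (last_color w == 0)) => //= w0.
  have : w \in wreath0 alpha.+1 n by rewrite inE.
  move/fdes_ccompl/(congr1 Posz); rewrite PoszD PoszM -subzn // => <-.
  by apply/eqP/eqP; lia.
rewrite !eval_frac_Fpoly mulr_sumr (reindex_inj (inv_inj (@ccomplK _ _))) /=.
apply: eq_big => w; first exact: ccompl_wreath0.
rewrite ccompl_wreath0 => /fdes_ccompl <-.
have x0 : x != 0 by rewrite tofrac_eq0 polyX_eq0.
by rewrite exprD exprVn mulfK // expf_neq0.
Qed.
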